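(* Let $q=\min\{m,n\}$, $r\in\{1,\dots,q\}$, $\gamma>0$, $0<\rho<2$, and let $f_2:\mathbb{R}^{n\times m}\to\mathbb{R}\cup\{\infty\}$ be a proper, closed, convex function. Let $X^\star\in\mathbb{R}^{n\times m}$ with $\mathrm{rank}(X^\star)\le r$. Then $X^\star$ is a limit point of the convex (respectively, non-convex) Douglas–Rachford splitting iterate $X_k$ if and only if there exists $R\in\mathbb{R}^{n\times m}$ such that $$R^TX^\star=0,\qquad X^\star R^T=0,\qquad -X^\star-R\in\partial f_2(X^\star),$$ and - in the convex case: $\sigma_1(R)\le\sigma_r(X^\star)$; - in the non-convex case: $\sigma_1(R)\le(1+\gamma^{-1})\,\sigma_r(X^\star)$.
   Context: For $X\in\mathbb{R}^{n\times m}$, $\sigma_1(X)\ge\dots\ge\sigma_q(X)$ are its singular values counted with multiplicity; $\langle X,Y\rangle=\mathrm{trace}(X^TY)$; $\|X\|_{\ell_2}=\sqrt{\langle X,X\rangle}$ is the Frobenius norm. $\partial f_2(X)=\{G: f_2(Y)\ge f_2(X)+\langle G,Y-X\rangle\text{ for all }Y\}$ is the subdifferential. A function is closed if all its sublevel sets are closed. $\mathrm{prox}_f(Z):=\operatorname{argmin}_M[f(M)+\tfrac12\|M-Z\|_{\ell_2}^2]$ (a set of minimizers, identified with its element if it is a singleton). Let $f_1(M):=\tfrac12\|M\|_{\ell_2}^2+\chi_{\mathrm{rank}(\cdot)\le r}(M)$, where $\chi_{\mathrm{rank}(\cdot)\le r}(M)$ is $0$ if $\mathrm{rank}(M)\le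 r$ and $\infty$ otherwise. Its convex envelope (biconjugate) is $f_1^{**}=\tfrac12\|\cdot\|_{\ell_2,r*}^2$, where $\|\cdot\|_{\ell_2,r*}$ is the dual norm, with respect to $\langle\cdot,\cdot\rangle$, of $Y\mapsto\sqrt{\sum_{i=1}^r\sigma_i(Y)^2}$. The Douglas–Rachford iteration for a pair $(h,f_2)$ with parameters $\gamma,\rho$, started at $Z_0\in\mathbb{R}^{n\times m}$, is, for $k\ge1$, $$X_k\in\mathrm{prox}_{\gamma h}(Z_{k-1}),\qquad Y_k=\mathrm{prox}_{\gamma f_2}(2X_k-Z_{k-1}),\qquad Z_k=Z_{k-1}+\rho(Y_k-X_k).$$ The convex Douglas–Rachford splitting takes $h=f_1^{**}$; the non-convex one takes $h=f_1$. A matrix $X^\star$ is called a limit point of the iterate $X_k$ if there exist an initial point $Z_0$ and a sequence generated by the iteration such that $Z_k$ converges and $X_k\to X^\star$ (equivalently, there is a $Z^\star$ with $X^\star\in\mathrm{prox}_{\gamma h}(Z^\star)$ and $X^\star=\mathrm{prox}_{\gamma f_2}(2X^\star-Z^\star)$). *)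

(* Defs.v *)
From HB Require Import structures.
From mathcomp Require Import all_boot all_order all_algebra.
From mathcomp Require Import polyrcf.
From mathcomp Require Import all_classical all_reals all_analysis.

Set Implicit Arguments.
Unset Strict Implicit.
Unset Printing Implicit Defensive.

Import Order.TTheory GRing.Theory Num.Theory.
Import numFieldTopology.Exports numFieldNormedType.Exports.

Local Open Scope classical_set_scope.
Local Open Scope ring_scope.
Local Open Scope ereal_scope.

Section Defs.
Context {R : realType} {n m : nat}.
Implicit Types (X Y Z M G : 'M[R]_(n, m)) (f h : 'M[R]_(n, m) -> \bar R).

Definition inner X Y : R := \tr (X^T *m Y).

Definition frob X : R := Num.sqrt (inner X X).

(* Square roots of the eigenvalues of X^T X, with multiplicity, in
   nonincreasing order.  When n < m, the list before truncation has m entries,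
   of which the last m - n are zero. *)
Definition singular_values X : seq R :=
  let p := char_poly (X^T *m X) in
  take (minn n m)
    (sort >=%O (flatten [seq nseq (mup x p) (Num.sqrt x) | x <- rootsR p])).

(* The index i is 1-based; the values at i = 0 and i > minn n m are junk. *)
Definition sigma (i : nat) X : R := nth 0%R (singular_values X) i.-1.

Definition proper_fun f := (forall X, f X <> -oo) /\ (exists X, f X <> +oo).

Definition closed_fun f := forall a : R, closed [set X | f X <= a%:E].

Definition convex_fun f := forall (t : R) X Y, (0 <= t <= 1)%R ->
  f (t *: X + (1 - t) *: Y)%R <= t%:E * f X + (1 - t)%:E * f Y.

Definition subdifferential f X : set 'M[R]_(n, m) :=
  [set G | forall Y, f X + (inner G (Y - X))%:E <= f Y].

Definition prox f Z : set 'M[R]_(n, m) :=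
  let obj M := f M + (2^-1 * frob (M - Z) ^+ 2)%:E in
  [set M | forall N, obj M <= obj N].

Definition conjugate f Y : \bar R :=
  ereal_sup (range (fun X => (inner X Y)%:E - f X)).

Definition biconjugate f := conjugate (conjugate f).

Definition chi_rank (r : nat) M : \bar R :=
  if (\rank M <= r)%N then 0 else +oo.

Definition f1 (r : nat) M : \bar R := (2^-1 * frob M ^+ 2)%:E + chi_rank r M.

(* The iteration starts at Z 0; X 0 and Y 0 are irrelevant.  The second clause says that the proximal set
   of gamma f2 is a singleton and that Y k.+1 is its element. *)
Definition DR_iteration h f2 (gamma rho : R) (X Y Z : nat -> 'M[R]_(n, m)) :=
  forall k : nat,
  [/\ prox (fun M => gamma%:E * h M) (Z k) (X k.+1),
      prox (fun M => gamma%:E * f2 M) (2 *: X k.+1 - Z k)%R = [set Y k.+1] &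
      Z k.+1 = (Z k + rho *: (Y k.+1 - X k.+1))%R].

Definition DR_limit_point h f2 (gamma rho : R) (Xs : 'M[R]_(n, m)) :=
  exists X Y Z : nat -> 'M[R]_(n, m),
  [/\ DR_iteration h f2 gamma rho X Y Z,
      (exists Zs : 'M[R]_(n, m), Z k @[k --> \oo] --> Zs) &
      X k @[k --> \oo] --> Xs].

End Defs.

(* Main.v *)
Require Import Defs.
From HB Require Import structures.
From mathcomp Require Import all_boot all_order all_algebra.
From mathcomp Require Import all_classical all_reals all_analysis.
From mathcomp Require Import polyrcf complex.
From mathcomp Require Import ring lra.

(** A limit point X of the splitting is a point for which some Z satisfies
    X in prox_{gamma h} Z and (X - Z) / gamma in the subdifferential of f2 at X
    ([DR_limit_pointP]).  Writing Z = X + gamma (X + R), the second relation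
    is the inclusion of - X - R in the subdifferential, so that only the first
    one has to be analysed, for h = f1** and for h = f1.

    Both cases reduce to one statement about matrices,
    [rank_constrained_minimizer]: for X of rank at most r, the function
    |M|^2 / 2 - <M, X + S> is minimal over rank M <= r at M = X exactly when
    S is orthogonal to X on both sides and sigma_1 S <= sigma_r X.  This is the
    Eckart-Young theorem together with a description of all its minimizers.

    - For h = f1**, the proximal relation says that X + R is a subgradient of
      f1** at X.  Since f1** and f1 agree on matrices of rank at most r, this is
      the minimality above with S = R
      ([subdifferential_biconjugate_f1]).
    - For h = f1, expanding the proximal objective gives (1 + gamma) times the
      function above with S = gamma / (1 + gamma) R, up to a constant; rescaling
      the singular value bound produces the factor 1 + 1 / gamma.

    The inequalities on singular values come from the spectral theorem
    ([symmetric_diagonalization]) applied to X^T X: the sorted roots of its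
    characteristic polynomial are the diagonal entries of a diagonal form, as
    many of them are nonzero as the rank of X, and sigma_1 and sigma_r are
    therefore read off as bounds on quadratic forms. *)

Set Implicit Arguments.
Unset Strict Implicit.
Unset Printing Implicit Defensive.

Import Order.TTheory GRing.Theory Num.Theory.
Import numFieldTopology.Exports numFieldNormedType.Exports.
Local Open Scope classical_set_scope.
Local Open Scope ring_scope.

(** * Spectral theorem for real symmetric matrices *)

Lemma mulTmx_eq0 (R : rcfType) (n m : nat) (X : 'M[R]_(n, m)) :
  X^T *m X = 0 -> X = 0.
Proof.
move=> XX; apply/matrixP => i j; rewrite mxE.
have := congr1 (fun M : 'M[R]_m => M j j) XX; rewrite !mxE => /eqP.
rewrite psumr_eq0 => [|k _]; last by rewrite !mxE -expr2 sqr_ge0.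
move=> /allP /(_ i (mem_index_enum _)); rewrite !mxE mulf_eq0 orbb.
by move=> /eqP.
Qed.

(** Over the complex extension of R an eigenvalue exists; comparing both sides of
    v A v* = a v v* with their conjugates shows that it is real, and hence a
    root of the real characteristic polynomial. *)
Lemma symmetric_eigenvalue (R : rcfType) (n : nat) (A : 'M[R]_n.+1) :
  A^T = A -> exists a, eigenvalue A a.
Proof.
move=> symA; pose f := real_complex R.
have [a] := eigenvalue_closed (map_mx f A) isT.
move=> /eigenvalueP[v vA vn0].
pose vs := map_mx conjc v^T.
have As : map_mx conjc (map_mx f A)^T = map_mx f A.
  by apply/matrixP => i j; rewrite -{2}symA !mxE conjc_real.
have nn0 : (v *m vs) 0 0 != 0.
  rewrite mxE psumr_eq0 => [|j _]; last by rewrite !mxE; exact: mulcJ_ge0.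
  apply: contraNN vn0 => /allP h; apply/eqP/rowP => j; rewrite mxE.
  have := h j (mem_index_enum _); rewrite !mxE /= mulf_eq0 conjc_eq0 orbb.
  by move=> /eqP.
have e1 : v *m map_mx f A *m vs = a *: (v *m vs) by rewrite vA -scalemxAl.
have e2 : v *m map_mx f A *m vs = conjc a *: (v *m vs).
  rewrite -mulmxA -As -map_mxM -trmx_mul vA linearZ /= map_mxZ /=.
  by rewrite -scalemxAr.
have /esym aJ : a = conjc a.
  apply: (mulIf nn0); have := congr1 (fun M : 'M[complex R]_1 => M 0 0) e1.
  by rewrite e2 !mxE.
exists (complex.Re a); rewrite eigenvalue_root_char.
rewrite -(fmorph_root f) map_char_poly /= -eigenvalue_root_char.
apply/eigenvalueP; exists v => //; rewrite vA; congr (_ *: _).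
apply/eqP; rewrite eq_complex /= eqxx /=.
by case: (a) aJ => x y [] /= /eqP; rewrite eq_sym -addr_eq0 -mulr2n mulrn_eq0.
Qed.

(** The witness is the Householder reflection exchanging u and the first basis
    vector; it degenerates to the identity when they coincide. *)
Lemma unit_row_completion (R : rcfType) (n : nat) (u : 'rV[R]_(1 + n)) :
  u *m u^T = 1%:M -> exists2 P : 'M[R]_(1 + n), P *m P^T = 1%:M & row 0 P = u.
Proof.
move=> uu; pose e : 'rV[R]_(1 + n) := delta_mx 0 0; pose w := e - u.
have ee : e *m e^T = 1%:M.
  by rewrite trmx_delta mul_delta_mx; apply/matrixP=> i j; rewrite !ord1 !mxE.
have ue : u *m e^T = (u 0 0)%:M.
  by rewrite trmx_delta; apply/matrixP => i j; rewrite !ord1 -colE !mxE.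
have eu : e *m u^T = (u 0 0)%:M.
  by rewrite -[LHS]trmxK trmx_mul trmxK ue tr_scalar_mx.
have ww : w *m w^T = (2 * (1 - u 0 0))%:M.
  rewrite /w linearB mulmxBl !mulmxBr ee uu ue eu.
  by rewrite -!raddfB /=; congr (_%:M); ring.
have ew : e *m w^T = (1 - u 0 0)%:M.
  by rewrite /w linearB mulmxBr ee eu -raddfB.
pose c := 1 - u 0 0.
have [c0|cn0] := eqVneq c 0.
  exists 1%:M; first by rewrite trmx1 mulmx1.
  have : w = 0.
    apply: trmx_inj; rewrite trmx0; apply: mulTmx_eq0.
    by rewrite trmxK ww -/c c0 mulr0 raddf0.
  move=> /eqP; rewrite subr_eq0 => /eqP <-.
  by rewrite /e rowE mulmx1.
pose P : 'M[R]_(1 + n) := 1%:M - c^-1 *: (w^T *m w).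
have Ps : P^T = P.
  by rewrite /P linearB /= trmx1 linearZ /= trmx_mul trmxK.
exists P.
  rewrite Ps {1}/P mulmxBl mul1mx {2}/P mulmxBr mulmx1 -!scalemxAl.
  rewrite {1}/P -scalemxAr scalerA.
  have -> : w^T *m w *m (w^T *m w) = (2 * c) *: (w^T *m w).
    by rewrite mulmxA -(mulmxA _ w) ww mul_mx_scalar -scalemxAl.
  rewrite scalerA (_ : _ * (2 * c) = c^-1 + c^-1); last by field.
  by rewrite scalerDl opprB addrK subrK.
rewrite rowE -/e /P mulmxBr mulmx1 -scalemxAr mulmxA ew -/c mul_scalar_mx.
by rewrite scalerA mulVf // scale1r /w subKr.
Qed.

(** Deflation: conjugating by an orthogonal matrix whose first row is a unit
    eigenvector splits off a 1 x 1 block, and symmetry kills the off-diagonal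
    blocks. *)
Theorem symmetric_diagonalization (R : rcfType) (n : nat) (A : 'M[R]_n) :
  A^T = A -> exists (P : 'M[R]_n) (d : 'rV[R]_n),
    P *m P^T = 1%:M /\ A = P^T *m diag_mx d *m P.
Proof.
elim: n A => [|n IHn] A symA.
  by exists 1%:M, 0; split; apply/matrixP => -[].
have [a /eigenvalueP[v vA vn0]] := symmetric_eigenvalue symA.
have vv_gt0 : 0 < (v *m v^T) 0 0.
  rewrite lt_def; apply/andP; split; last first.
    by rewrite mxE sumr_ge0 // => j _; rewrite mxE -expr2 sqr_ge0.
  apply: contraNneq vn0 => vv0; apply/eqP/trmx_inj.
  rewrite trmx0; apply: mulTmx_eq0.
  by rewrite trmxK [v *m _]mx11_scalar vv0 raddf0.
pose u : 'rV[R]_(1 + n) := (Num.sqrt ((v *m v^T) 0 0))^-1 *: v.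
have uA : u *m A = a *: u by rewrite /u -scalemxAl vA !scalerA mulrC.
have uu : u *m u^T = 1%:M.
  rewrite /u linearZ /= -scalemxAl -scalemxAr scalerA -expr2 exprVn.
  rewrite sqr_sqrtr ?(ltW vv_gt0) // {2}[v *m _]mx11_scalar scale_scalar_mx.
  by rewrite mulVf // gt_eqF.
have [H HH Hu] := unit_row_completion uu.
have HTH := mulmx1C HH.
pose B := H *m A *m H^T : 'M[R]_(1 + n).
have symB : B^T = B by rewrite /B !trmx_mul trmxK symA mulmxA.
have rB : row 0 B = a *: delta_mx 0 0.
  by rewrite /B !row_mul Hu uA -Hu rowE -scalemxAl -mulmxA HH mulmx1.
have urB : ursubmx B = 0.
  apply/matrixP => i j; rewrite ord1 [LHS]mxE [LHS]mxE [RHS]mxE.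
  have := congr1 (fun M : 'rV[R]_(1 + n) => M 0 (rshift 1 j)) rB.
  rewrite /= [LHS]mxE => E; rewrite (_ : lshift n 0 = 0) ?E; last exact: val_inj.
  by rewrite !mxE mulr0.
have ulB : ulsubmx B = a%:M.
  apply/matrixP => i j; rewrite !ord1 [LHS]mxE [LHS]mxE [RHS]mxE.
  have := congr1 (fun M : 'rV[R]_(1 + n) => M 0 0) rB.
  rewrite /= [LHS]mxE => E; rewrite (_ : lshift n 0 = 0) ?E; last exact: val_inj.
  by rewrite !mxE !eqxx mulr1.
have dlB : dlsubmx B = 0 by rewrite -[dlsubmx B]trmxK trmx_dlsub symB urB trmx0.
have symB' : (drsubmx B)^T = drsubmx B by rewrite trmx_drsub symB.
have [Q [d [QQ BE]]] := IHn _ symB'.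
pose K : 'M[R]_(1 + n) := block_mx 1%:M 0 0 Q.
have KT : K^T = block_mx 1%:M 0 0 Q^T.
  by rewrite /K (tr_block_mx 1%:M) trmx1 !trmx0.
have KK : K *m K^T = 1%:M.
  rewrite KT /K mulmx_block !mulmx0 !mul0mx !addr0 add0r mulmx1 QQ.
  by rewrite -scalar_mx_block.
pose D : 'rV[R]_(1 + n) := row_mx a%:M d.
have KDK : K^T *m diag_mx D *m K = B.
  rewrite KT /K /D diag_mx_row !mulmx_block.
  rewrite !(mulmx0, mul0mx, addr0, add0r, mulmx1, mul1mx) -BE.
  rewrite (_ : diag_mx a%:M = a%:M); last first.
    by apply/matrixP => i j; rewrite !ord1 !mxE.
  by rewrite -[B in RHS]submxK ulB urB dlB.
exists (K *m H), D; split.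
  by rewrite trmx_mul mulmxA -(mulmxA K) HH mulmx1.
transitivity (H^T *m B *m H).
  by rewrite /B !mulmxA HTH mul1mx -mulmxA HTH mulmx1.
by rewrite -KDK trmx_mul !mulmxA.
Qed.

(** * Gram matrices and row-space projections *)

Lemma quad_diag (R : rcfType) (n : nat) (P : 'M[R]_n) (d v : 'rV[R]_n) :
  (v *m (P^T *m diag_mx d *m P) *m v^T) 0 0 =
  \sum_i d 0 i * (v *m P^T) 0 i ^+ 2.
Proof.
have -> : v *m (P^T *m diag_mx d *m P) *m v^T =
    (v *m P^T) *m diag_mx d *m (v *m P^T)^T.
  by rewrite trmx_mul trmxK !mulmxA.
rewrite mxE; apply: eq_bigr => i _.
by rewrite mul_mx_diag !mxE expr2 mulrAC mulrC mulrA.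
Qed.

Lemma quad_gram (R : rcfType) (n m : nat) (X : 'M[R]_(n, m)) (v : 'rV[R]_m) :
  (v *m (X^T *m X) *m v^T) 0 0 = \sum_i (v *m X^T) 0 i ^+ 2.
Proof.
have -> : v *m (X^T *m X) *m v^T = (v *m X^T) *m (v *m X^T)^T.
  by rewrite trmx_mul trmxK !mulmxA.
by rewrite mxE; apply: eq_bigr => i _; rewrite [in X in _ * X]mxE expr2.
Qed.

Lemma gram_diagonalization (R : rcfType) (n m : nat) (X : 'M[R]_(n, m)) :
  exists (P : 'M[R]_m) (d : 'rV[R]_m),
    [/\ P *m P^T = 1%:M, X^T *m X = P^T *m diag_mx d *m P &
        forall i, 0 <= d 0 i].
Proof.
have symG : (X^T *m X)^T = X^T *m X by rewrite trmx_mul trmxK.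
have [P [d [PP XX]]] := symmetric_diagonalization symG.
exists P, d; split=> // i.
have := quad_gram X (row i P); rewrite XX quad_diag.
rewrite (bigD1 i) //= big1 => [|j ji].
  rewrite addr0 -row_mul PP row1 !mxE !eqxx expr1n mulr1 => ->.
  by apply: sumr_ge0 => j _; exact: sqr_ge0.
by rewrite -row_mul PP row1 !mxE (negbTE ji) andbF expr0n mulr0.
Qed.

(** With X^T X = P^T diag(d) P, this is the orthogonal projection on the row
    space of X. *)
Definition support_proj (R : rcfType) (m : nat) (P : 'M[R]_m) (d : 'rV[R]_m) :=
  P^T *m diag_mx (\row_i (d 0 i != 0)%:R) *m P.

Lemma orthogonal_conj_mul (R : rcfType) (m : nat) (P : 'M[R]_m) (d e : 'rV[R]_m) :
  P *m P^T = 1%:M ->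
  (P^T *m diag_mx d *m P) *m (P^T *m diag_mx e *m P) =
  P^T *m diag_mx (\row_i (d 0 i * e 0 i)) *m P.
Proof.
move=> PP; rewrite -!mulmxA (mulmxA P) PP mul1mx (mulmxA (diag_mx d)).
by rewrite mulmx_diag.
Qed.

(** In a full-rank factorization Q = C B, idempotence forces B C = 1, and the
    trace of C B is that of B C. *)
Lemma mxtrace_idempotent (R : fieldType) (m : nat) (Q : 'M[R]_m) :
  Q *m Q = Q -> \tr Q = (\rank Q)%:R.
Proof.
move=> QQ.
have BC : row_base Q *m col_base Q = 1%:M.
  have [fB fC] := (row_base_free Q, col_base_full Q).
  move: QQ; rewrite -{1 2 3}(mulmx_base Q).
  move: (row_base Q) (col_base Q) fB fC => B C fB fC E.
  apply: (row_full_inj fC); apply: (row_free_inj fB).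
  by rewrite /= mulmx1 -E !mulmxA.
by rewrite -{1}(mulmx_base Q) mxtrace_mulC BC mxtrace1.
Qed.

Section SupportProj.
Variables (R : rcfType) (n m : nat) (X : 'M[R]_(n, m)).
Variables (P : 'M[R]_m) (d : 'rV[R]_m).
Hypotheses (PP : P *m P^T = 1%:M) (XX : X^T *m X = P^T *m diag_mx d *m P).
Let Q := support_proj P d.

Lemma support_proj_sym : Q^T = Q.
Proof. by rewrite /Q /support_proj !trmx_mul trmxK tr_diag_mx mulmxA. Qed.

Lemma support_proj_idem : Q *m Q = Q.
Proof.
rewrite /Q /support_proj orthogonal_conj_mul //; congr (_ *m diag_mx _ *m _).
by apply/rowP => i; rewrite !mxE; case: (_ == _); rewrite /= ?mulr0 ?mulr1.
Qed.

Lemma support_projK : X *m Q = X.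
Proof.
have E : X^T *m X *m (1%:M - Q) = 0.
  rewrite mulmxBr mulmx1 XX /Q /support_proj orthogonal_conj_mul //.
  apply/eqP; rewrite subr_eq0; apply/eqP; congr (_ *m diag_mx _ *m _).
  apply/rowP => i; rewrite !mxE.
  by case: eqP => [->|_]; rewrite ?mul0r ?mulr1.
apply/esym/eqP; rewrite -subr_eq0 -[X in X - _]mulmx1 -mulmxBr; apply/eqP.
by apply: mulTmx_eq0; rewrite trmx_mul -mulmxA (mulmxA X^T) E mulmx0.
Qed.

(** The pseudo-inverse of the Gram matrix: inverting the nonzero eigenvalues
    (the inverse of 0 being 0) recovers the projection from X^T X. *)
Lemma support_proj_factor : exists W, Q = W *m X.
Proof.
exists (P^T *m diag_mx (\row_i (d 0 i)^-1) *m P *m X^T).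
rewrite -mulmxA XX orthogonal_conj_mul //; congr (_ *m diag_mx _ *m _).
apply/rowP => i; rewrite !mxE; have [->|d0] := eqVneq; first by rewrite mulr0.
by rewrite mulVf.
Qed.

Lemma support_proj_rank : \rank Q = \rank X.
Proof.
have [W QW] := support_proj_factor.
apply/eqP; rewrite eqn_leq -{2}support_projK QW mxrankM_maxr /=.
by rewrite -QW mxrankM_maxr.
Qed.

Lemma support_proj_trace : \tr Q = (\rank X)%:R.
Proof. by rewrite mxtrace_idempotent ?support_proj_idem // support_proj_rank. Qed.

Lemma count_support : (\sum_i (d 0%R i != 0%R) = \rank X)%N.
Proof.
apply/eqP; rewrite -(eqr_nat R) -support_proj_trace /Q /support_proj.
rewrite -mulmxA mxtrace_mulC -mulmxA PP mulmx1 mxtrace_diag natr_sum.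
by apply/eqP/eq_bigr => i _; rewrite mxE.
Qed.
End SupportProj.

(** * Singular values as eigenvalues of the Gram matrix *)

(** In a nonincreasing nonnegative list the nonzero entries form an initial
    segment.  This turns the rank, which counts nonzero eigenvalues, into a
    statement about the value at a given position. *)
Lemma nth_sorted_neq0 (R : realDomainType) (s : seq R) (i : nat) :
  sorted >=%O s -> all (fun x => 0 <= x) s ->
  (nth 0 s i != 0) = (i < count (fun x : R => x != 0%R) s)%N.
Proof.
elim: s i => [|x s IHs] i; first by rewrite nth_nil eqxx.
move=> /= xs /andP[x0 s0].
have IH := IHs _ (path_sorted xs) s0.
have /allP gex : all (fun y => y <= x) s.
  by move: xs; rewrite path_sortedE => [/andP[]//|a b c /= h h']; exact: le_trans h' h.
case: i => [|i] /=; last first.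
  have [x_eq0|//] := eqVneq x 0.
  have z k : nth 0 s k = 0.
    case: (ltnP k (size s)) => [ks|?]; last by rewrite nth_default.
    apply/eqP; rewrite eq_le (allP s0) ?mem_nth // andbT -x_eq0.
    by apply: gex; rewrite mem_nth.
  by rewrite add0n z; have := IH i.+1; rewrite z.
have [x_eq0|//] := eqVneq x 0.
rewrite add0n -(IH 0); apply/esym/negbTE; rewrite negbK.
case: s gex s0 {xs IH IHs} => //= y s gex /andP[y0 _].
by rewrite eq_le y0 -x_eq0 andbT gex ?mem_head.
Qed.

(** The characteristic polynomial is invariant under orthogonal conjugation, so
    it is the product of the 'X - d_i, and reading its roots with their
    multiplicities gives back the d_i up to order. *)
Lemma singular_values_gram (R : realType) (n m : nat) (X : 'M[R]_(n, m))
    (P : 'M[R]_m) (d : 'rV[R]_m) :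
  P *m P^T = 1%:M -> X^T *m X = P^T *m diag_mx d *m P ->
  singular_values X =
  take (minn n m) (sort >=%O [seq Num.sqrt (d 0 i) | i <- enum 'I_m]).
Proof.
move=> PP XX; rewrite /singular_values; congr (take _ _).
apply/perm_sortP.
- by move=> x y; rewrite /= le_total.
- by move=> x y z /= h h'; exact: le_trans h' h.
- by move=> x y /=; rewrite andbC; exact: le_anti.
pose s := [seq d 0 i | i <- enum 'I_m].
have pE : char_poly (X^T *m X) = \prod_(y <- s) ('X - y%:P).
  rewrite big_map big_enum /=.
  have <- : char_poly (diag_mx d) = \prod_i ('X - (d 0 i)%:P).
    rewrite char_poly_trig; last first.
      by apply/is_trig_mxP => i j ij; rewrite mxE lt_eqF ?mulr0n.
    by apply: eq_bigr => i _; rewrite mxE eqxx.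
  rewrite XX /char_poly.
  have -> : char_poly_mx (P^T *m diag_mx d *m P) =
      map_mx polyC P^T *m char_poly_mx (diag_mx d) *m map_mx polyC P.
    rewrite /char_poly_mx mulmxBr mulmxBl -!map_mxM; congr (_ - _).
    by rewrite mul_mx_scalar -scalemxAl -map_mxM (mulmx1C PP) map_mx1 scalemx1.
  rewrite !det_mulmx mulrAC -det_mulmx -map_mxM (mulmx1C PP) map_mx1 det1.
  by rewrite mul1r.
rewrite pE; set p := \prod_(y <- s) _.
have p0 : p != 0 by rewrite monic_neq0 // monic_prod_XsubC.
have -> : [seq Num.sqrt (d 0 i) | i <- enum 'I_m] = map Num.sqrt s.
  by rewrite /s -[RHS]map_comp.
have -> : flatten [seq nseq (mup x p) (Num.sqrt x) | x <- rootsR p] =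
    map Num.sqrt (flatten [seq nseq (count_mem x s) x | x <- rootsR p]).
  rewrite map_flatten -map_comp; congr flatten; apply: eq_map => x /=.
  by rewrite map_nseq mu_prod_XsubC.
apply/perm_map/(perm_trans _ (perm_count_undup s))/perm_flatten/perm_map.
apply: uniq_perm; rewrite ?undup_uniq ?uniq_roots // => x.
by rewrite mem_undup -(roots_on_rootsR p0) /= root_prod_XsubC.
Qed.

Section SigmaGram.
Variables (R : realType) (n m : nat) (X : 'M[R]_(n, m)).
Variables (P : 'M[R]_m) (d : 'rV[R]_m).
Hypotheses (PP : P *m P^T = 1%:M) (XX : X^T *m X = P^T *m diag_mx d *m P).
Hypothesis d_ge0 : forall i, 0 <= d 0 i.
Variable r : nat.
Hypothesis hr : (1 <= r <= minn n m)%N.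
Let L := sort >=%O [seq Num.sqrt (d 0 i) | i <- enum 'I_m].

Let r_le_m : (r <= m)%N.
Proof. by move: hr; rewrite leq_min => /and3P[]. Qed.

Let L_sorted : sorted >=%O L.
Proof. by apply: sort_sorted => x y; rewrite /= le_total. Qed.

Let L_ge0 : all (fun x => 0 <= x) L.
Proof.
by apply/allP => x; rewrite mem_sort => /mapP[i _ ->]; exact: sqrtr_ge0.
Qed.

Let size_L : size L = m.
Proof. by rewrite size_sort size_map size_enum_ord. Qed.

Let mem_L i : Num.sqrt (d 0 i) \in L.
Proof. by rewrite mem_sort; apply: map_f; rewrite mem_enum. Qed.

Let L_neq0 k : (nth 0 L k != 0) = (k < \rank X)%N.
Proof.
rewrite nth_sorted_neq0 //; congr (_ < _)%N.
rewrite count_sort count_map -sum1_count big_enum_cond /= -(count_support PP XX).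
rewrite big_mkcond /=; apply: eq_bigr => i _.
by rewrite sqrtr_eq0 le_eqVlt ltNge d_ge0 orbF; case: (_ == _).
Qed.

Let sigma_nth k : (1 <= k <= r)%N -> sigma k X = nth 0 L k.-1.
Proof.
move=> /andP[k1 kr]; rewrite /sigma (singular_values_gram PP XX).
by rewrite nth_take //; move: hr => /andP[_ /(leq_trans kr)]; case: k k1 {kr}.
Qed.

Let sigma_r : sigma r X = nth 0 L r.-1.
Proof. by apply: sigma_nth; rewrite leqnn andbT; case/andP: hr. Qed.

Let L_nonincr j k : (j <= k < m)%N -> nth 0 L k <= nth 0 L j.
Proof.
move=> /andP[jk km]; have jm := leq_ltn_trans jk km.
have tr : transitive (>=%O : rel R) by move=> x y z /= h h'; exact: le_trans h' h.
by apply: (sorted_leq_nth tr (@lexx _ R) 0 L_sorted); rewrite ?inE ?size_L.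
Qed.

Lemma sigma_ge0_gram : 0 <= sigma r X.
Proof.
rewrite sigma_r; apply: (allP L_ge0); apply: mem_nth; rewrite size_L.
by case: r hr r_le_m.
Qed.

(** This dichotomy lets the estimates below treat the rank-deficient case
    uniformly: under the rank bound, sigma_r * rank X = sigma_r * r. *)
Lemma sigma_eq0_or_rank : (\rank X <= r)%N -> sigma r X = 0 \/ \rank X = r.
Proof.
rewrite sigma_r leq_eqVlt => /predU1P[|rk]; [by right|left].
by apply/eqP/negbNE; rewrite L_neq0 -leqNgt -ltnS prednK //; case/andP: hr.
Qed.

Lemma sigma_neq0 : \rank X = r -> sigma r X != 0.
Proof. by rewrite sigma_r L_neq0 => ->; case: r hr. Qed.

Lemma sigma_exists_gram : exists i, d 0 i = sigma r X ^+ 2.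
Proof.
rewrite sigma_r; have : nth 0 L r.-1 \in L.
  by apply: mem_nth; rewrite size_L; case: r hr r_le_m.
rewrite {1}/L mem_sort => /mapP[i _ ->]; exists i.
by rewrite sqr_sqrtr.
Qed.

(** The r-th singular value bounds the nonzero part of the spectrum from below:
    under the rank bound, a nonzero eigenvalue sits at one of the first r
    positions of the sorted list. *)
Lemma sigma_le_gram i : (\rank X <= r)%N -> d 0 i != 0 -> sigma r X ^+ 2 <= d 0 i.
Proof.
move=> rk di0; rewrite -(sqr_sqrtr (d_ge0 i)) sigma_r.
have r0 : (r.-1 < m)%N by case: r hr r_le_m.
rewrite ler_sqr ?nnegrE ?sqrtr_ge0 //; last by rewrite -sigma_r sigma_ge0_gram.
have /(nthP 0)[k] := mem_L i; rewrite size_L => km Ek; rewrite -Ek.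
apply: L_nonincr; rewrite r0 andbT.
have : nth 0 L k != 0.
  by rewrite Ek sqrtr_eq0 -ltNge lt_def di0 d_ge0.
rewrite L_neq0 => /leq_trans/(_ rk).
by case: r hr.
Qed.

Lemma gram_le_sigma1 i : d 0 i <= sigma 1 X ^+ 2.
Proof.
have r1 : (1 <= r)%N by case/andP: hr.
rewrite sigma_nth ?r1 // -(sqr_sqrtr (d_ge0 i)).
have /(nthP 0)[k] := mem_L i; rewrite size_L => km Ek; rewrite -Ek.
rewrite ler_sqr ?nnegrE ?(allP L_ge0) ?mem_nth ?size_L ?(leq_ltn_trans _ km) //.
by rewrite L_nonincr.
Qed.

Lemma sigma1_exists_gram : exists i, d 0 i = sigma 1 X ^+ 2.
Proof.
have r1 : (1 <= r)%N by case/andP: hr.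
have m1 : (0 < m)%N := leq_trans r1 r_le_m.
rewrite sigma_nth ?r1 //; have : nth 0 L 0 \in L by rewrite mem_nth ?size_L.
by rewrite {1}/L mem_sort => /mapP[i _ ->]; exists i; rewrite sqr_sqrtr.
Qed.
End SigmaGram.


Lemma sigma_ge0 (R : realType) (n m r : nat) (X : 'M[R]_(n, m)) :
  (1 <= r <= minn n m)%N -> 0 <= sigma r X.
Proof.
have [P [d [PP XX _]]] := gram_diagonalization X.
exact: (sigma_ge0_gram PP XX).
Qed.

(** The spectral norm, squared, is the largest value of the quadratic form of the
    Gram matrix on unit vectors. *)
Lemma sigma1_le (R : realType) (n m : nat) (X : 'M[R]_(n, m)) (c : R) :
  (1 <= minn n m)%N -> 0 <= c ->
  sigma 1 X <= c <->
  forall v : 'rV[R]_m, (v *m (X^T *m X) *m v^T) 0 0 <= c ^+ 2 * (v *m v^T) 0 0.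
Proof.
move=> nm c0; have [P [d [PP XX d0]]] := gram_diagonalization X.
have hr : (1 <= 1 <= minn n m)%N by [].
have s0 : 0 <= sigma 1 X := sigma_ge0 _ hr.
have vv (v : 'rV_m) : (v *m v^T) 0 0 = \sum_i (v *m P^T) 0 i ^+ 2.
  have -> : v *m v^T = (v *m P^T) *m (v *m P^T)^T.
    by rewrite trmx_mul trmxK -mulmxA (mulmxA P^T) (mulmx1C PP) mul1mx.
  by rewrite mxE; apply: eq_bigr => i _; rewrite [in X in _ * X]mxE expr2.
split=> [sc v|h].
  rewrite XX quad_diag vv mulr_sumr; apply: ler_sum => i _.
  apply: ler_wpM2r; first exact: sqr_ge0.
  apply: le_trans (gram_le_sigma1 PP XX d0 hr i) _.
  by rewrite ler_sqr ?nnegrE.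
have [i di] := sigma1_exists_gram PP XX d0 hr.
have := h (row i P); rewrite XX quad_diag vv -!row_mul PP row1.
rewrite (bigD1 i) // [X in _ <= _ * X](bigD1 i) //= !big1 => [|j ji|j ji].
- by rewrite !mxE !eqxx !addr0 expr1n !mulr1 di ler_sqr ?nnegrE.
- by rewrite !mxE (negbTE ji) andbF expr0n.
- by rewrite !mxE (negbTE ji) andbF expr0n mulr0.
Qed.

Lemma sigma1_scale_le (R : realType) (n m : nat) (S : 'M[R]_(n, m)) (c s : R) :
  (1 <= minn n m)%N -> 0 < c -> 0 <= s ->
  (sigma 1 (c *: S) <= s) = (sigma 1 S <= c^-1 * s).
Proof.
move=> nm c0 s0; have cs0 : 0 <= c^-1 * s by rewrite mulr_ge0 // invr_ge0 ltW.
have E v : (v *m ((c *: S)^T *m (c *: S)) *m v^T) 0 0 =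
    c ^+ 2 * (v *m (S^T *m S) *m v^T) 0 0.
  have -> : (c *: S)^T *m (c *: S) = c ^+ 2 *: (S^T *m S).
    by rewrite [(c *: S)^T]linearZ /= -scalemxAl -scalemxAr scalerA.
  by rewrite -scalemxAr -scalemxAl [LHS]mxE.
have c20 : 0 < c ^+ 2 by rewrite exprn_gt0.
have C (x y : R) : (c ^+ 2 * x <= s ^+ 2 * y) = (x <= (c^-1 * s) ^+ 2 * y).
  rewrite -(ler_pM2l c20 x); congr (_ <= _).
  by field; rewrite gt_eqF.
apply/idP/idP => [/(sigma1_le _ nm s0) h|/(sigma1_le _ nm cs0) h].
  by apply/(sigma1_le _ nm cs0) => v; rewrite -C -E.
by apply/(sigma1_le _ nm s0) => v; rewrite E C.
Qed.

(** * The trace inner product *)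

Section Inner.
Variables (R : realType) (n m : nat).
Implicit Types X Y Z : 'M[R]_(n, m).

Lemma innerC X Y : inner X Y = inner Y X.
Proof. by rewrite /inner -mxtrace_tr trmx_mul trmxK. Qed.

Lemma innerDr X Y Z : inner X (Y + Z) = inner X Y + inner X Z.
Proof. by rewrite /inner mulmxDr linearD. Qed.

Lemma innerZr a X Y : inner X (a *: Y) = a * inner X Y.
Proof. by rewrite /inner -scalemxAr linearZ. Qed.

Lemma innerNr X Y : inner X (- Y) = - inner X Y.
Proof. by rewrite -scaleN1r innerZr mulN1r. Qed.

Lemma innerDl X Y Z : inner (X + Y) Z = inner X Z + inner Y Z.
Proof. by rewrite !(innerC _ Z) innerDr. Qed.

Lemma innerZl a X Y : inner (a *: X) Y = a * inner X Y.
Proof. by rewrite !(innerC _ Y) innerZr. Qed.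

Lemma innerNl X Y : inner (- X) Y = - inner X Y.
Proof. by rewrite !(innerC _ Y) innerNr. Qed.

Definition innerE :=
  (innerDl, innerDr, innerNl, innerNr, innerZl, innerZr).

Lemma inner_entries X Y : inner X Y = \sum_i \sum_j X i j * Y i j.
Proof.
rewrite /inner /mxtrace exchange_big; apply: eq_bigr => j _.
by rewrite mxE; apply: eq_bigr => i _; rewrite mxE.
Qed.

Lemma inner_ge0 X : 0 <= inner X X.
Proof.
rewrite inner_entries; apply: sumr_ge0 => i _; apply: sumr_ge0 => j _.
by rewrite -expr2 sqr_ge0.
Qed.

Lemma inner_eq0 X : inner X X = 0 -> X = 0.
Proof.
rewrite inner_entries => /eqP; rewrite psumr_eq0 => [/allP h|i _]; last first.
  by apply: sumr_ge0 => j _; rewrite -expr2 sqr_ge0.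
apply/matrixP => i j; rewrite mxE.
have /= := h i (mem_index_enum _); rewrite psumr_eq0 => [|k _]; last first.
  by rewrite -expr2 sqr_ge0.
by move=> /allP/(_ j (mem_index_enum _)); rewrite /= mulf_eq0 orbb => /eqP.
Qed.

Lemma frob_sqr X : frob X ^+ 2 = inner X X.
Proof. by rewrite sqr_sqrtr // inner_ge0. Qed.
End Inner.

Lemma inner_mull (R : realType) (n m p : nat) (A : 'M[R]_(n, p))
    (X : 'M[R]_(p, m)) (Y : 'M[R]_(n, m)) :
  inner (A *m X) Y = inner X (A^T *m Y).
Proof. by rewrite /inner trmx_mul mulmxA. Qed.

Lemma inner_mulr (R : realType) (n m p : nat) (X : 'M[R]_(n, p))
    (B : 'M[R]_(p, m)) (Y : 'M[R]_(n, m)) :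
  inner (X *m B) Y = inner X (Y *m B^T).
Proof. by rewrite /inner trmx_mul -mulmxA mxtrace_mulC mulmxA. Qed.

Lemma inner_gram (R : realType) (n m p : nat) (X : 'M[R]_(n, m))
    (A : 'M[R]_(m, p)) :
  inner (X *m A) (X *m A) = \tr (A^T *m (X^T *m X) *m A).
Proof. by rewrite /inner trmx_mul !mulmxA. Qed.

Lemma inner_tr (R : realType) (n m : nat) (X Y : 'M[R]_(n, m)) :
  inner X^T Y^T = inner X Y.
Proof. by rewrite innerC /inner trmxK mxtrace_mulC. Qed.

(** * Best approximation under a rank constraint *)

(** The trace of A^T G A is the sum of the quadratic form of G over the columns
    of A. *)
Lemma trace_conj_le (R : realType) (m p : nat) (G H : 'M[R]_m)
    (A : 'M[R]_(m, p)) :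
  (forall v : 'rV[R]_m, (v *m G *m v^T) 0 0 <= (v *m H *m v^T) 0 0) ->
  \tr (A^T *m G *m A) <= \tr (A^T *m H *m A).
Proof.
move=> GH; have E (K : 'M[R]_m) : \tr (A^T *m K *m A) =
    \sum_j (row j A^T *m K *m (row j A^T)^T) 0 0.
  apply: eq_bigr => j _; rewrite -!row_mul tr_row trmxK.
  by rewrite !mxE; apply: eq_bigr => k _; rewrite !mxE.
by rewrite !E; apply: ler_sum => j _.
Qed.

(** The Loewner inequality sigma_r^2 E <= X^T X, where E projects on the row space
    of X, in the integrated form in which it is used. *)
Lemma singular_projection (R : realType) (n m r : nat) (X : 'M[R]_(n, m)) :
  (1 <= r <= minn n m)%N -> (\rank X <= r)%N ->
  exists (E : 'M[R]_m) (W : 'M[R]_(m, n)),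
    [/\ E^T = E, E *m E = E, E = W *m X, \tr E = (\rank X)%:R &
        forall p (A : 'M[R]_(m, p)),
          sigma r X ^+ 2 * inner (E *m A) (E *m A) <= inner (X *m A) (X *m A)].
Proof.
move=> hr rk; have [P [d [PP XX d0]]] := gram_diagonalization X.
have [W EW] := support_proj_factor PP XX.
have Es := support_proj_sym P d; have EE := support_proj_idem d PP.
exists (support_proj P d), W; split=> //; first exact: support_proj_trace PP XX.
move=> p A; rewrite !inner_gram Es EE -mxtraceZ scalemxAl scalemxAr.
apply: trace_conj_le => v; rewrite -scalemxAr -scalemxAl mxE XX !quad_diag.
rewrite mulr_sumr; apply: ler_sum => i _; rewrite mulrA mxE.
apply: ler_wpM2r; first exact: sqr_ge0.
have [//|di0] := eqVneq; first by rewrite mulr0.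
by rewrite mulr1; apply: (sigma_le_gram PP XX d0 hr rk di0).
Qed.

Lemma row_projection (R : rcfType) (n m : nat) (X : 'M[R]_(n, m)) :
  exists Q : 'M[R]_m,
    [/\ Q^T = Q, Q *m Q = Q, X *m Q = X & \tr Q = (\rank X)%:R].
Proof.
have [P [d [PP XX _]]] := gram_diagonalization X.
exists (support_proj P d); split.
- exact: support_proj_sym.
- exact: support_proj_idem.
- exact: support_projK.
- exact: support_proj_trace PP XX.
Qed.

Lemma sigma1_le_inner (R : realType) (n m p : nat) (S : 'M[R]_(n, m)) (c : R)
    (A : 'M[R]_(m, p)) :
  (1 <= minn n m)%N -> 0 <= c -> sigma 1 S <= c ->
  inner (S *m A) (S *m A) <= c ^+ 2 * inner A A.
Proof.
move=> nm c0 /(sigma1_le _ nm c0) h.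
have <- : \tr (A^T *m (c ^+ 2)%:M *m A) = c ^+ 2 * inner A A.
  by rewrite mul_mx_scalar -scalemxAl mxtraceZ.
rewrite inner_gram; apply: trace_conj_le => v; apply: le_trans (h v) _.
by rewrite mul_mx_scalar -scalemxAl [leRHS]mxE.
Qed.

Lemma sigma_eigenrow (R : realType) (n m r : nat) (X : 'M[R]_(n, m)) :
  (1 <= r <= minn n m)%N ->
  exists u : 'rV[R]_m,
    u *m u^T = 1%:M /\ u *m (X^T *m X) = sigma r X ^+ 2 *: u.
Proof.
move=> hr; have [P [d [PP XX d0]]] := gram_diagonalization X.
have [i <-] := sigma_exists_gram PP XX d0 hr.
have PiP : row i P *m P^T = delta_mx 0 i by rewrite -row_mul PP row1.
exists (row i P); split.
  have : (row i P *m P^T) *m (row i P *m P^T)^T = 1%:M.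
    by rewrite PiP trmx_delta mul_delta_mx; apply/matrixP => a b; rewrite !ord1 !mxE.
  by rewrite trmx_mul trmxK -mulmxA (mulmxA P^T) (mulmx1C PP) mul1mx.
rewrite XX !mulmxA PiP -rowE row_diag_mx -scalemxAl.
by rewrite -rowE.
Qed.

(** The row u lies in the row space of X but is orthogonal to that of X (1 - u^T u),
    so the latter is strictly smaller. *)
Lemma rank_deflate (F : fieldType) (n m : nat) (X : 'M[F]_(n, m)) (u : 'rV[F]_m)  :
  u *m u^T = 1%:M -> (u <= X)%MS -> (\rank (X - X *m u^T *m u)%R < \rank X)%N.
Proof.
move=> uu uX; set Y := X - _.
have YX : (Y <= X)%MS.
  by rewrite /Y addmx_sub // eqmx_opp mulmx_sub.
rewrite ltn_neqAle mxrankS // andbT; apply/negP => /eqP rYX.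
have /submxP[K uK] : (u <= Y)%MS.
  by apply: submx_trans uX _; rewrite -(geq_leqif (mxrank_leqif_sup YX)) rYX.
have : u *m u^T = 0.
  rewrite {1}uK -mulmxA /Y mulmxBl -!mulmxA uu mulmx1 subrr mulmx0 //.
rewrite uu => /matrixP/(_ 0 0); rewrite !mxE /= => /eqP.
by rewrite (negbTE (oner_neq0 F)).
Qed.

Lemma tr_compl (R : nzRingType) (m : nat) (G : 'M[R]_m) :
  G^T = G -> (1%:M - G)^T = 1%:M - G.
Proof. by move=> Gs; rewrite linearB /= trmx1 Gs. Qed.

Lemma inner_proj_compl (R : realType) (m : nat) (F G : 'M[R]_m) :
  F^T = F -> F *m F = F -> G^T = G -> G *m G = G ->
  inner (F *m (1%:M - G)) (F *m (1%:M - G)) = \tr F - \tr (F *m G).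
Proof.
move=> Fs FF Gs GG; rewrite inner_gram Fs FF tr_compl //.
rewrite mxtrace_mulC mulmxA.
have -> : (1%:M - G) *m (1%:M - G) = 1%:M - G.
  by rewrite mulmxBl mul1mx mulmxBr mulmx1 GG subrr subr0.
by rewrite mulmxBl mul1mx linearB /= (mxtrace_mulC G).
Qed.

(** Let T = X + S and let Q be the projection on the row space of M.  Completing
    the square gives |M|^2 - 2 <M, T> >= - |T Q|^2, and orthogonality of X and S
    gives |T Q|^2 = |X Q|^2 + |S Q|^2.  It remains to see that |S Q|^2 is at most
    |X (1 - Q)|^2.  With E the projection on the row space of X and s = sigma_r X,
    the left side is at most s^2 (tr Q - tr (Q E)) because S = S (1 - E), and the
    right side is at least s^2 (tr E - tr (Q E)); finally
    s^2 tr Q <= s^2 r = s^2 tr E. *)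
Lemma rank_constrained_min_sufficient (R : realType) (n m r : nat)
    (X S M : 'M[R]_(n, m)) :
  (1 <= r <= minn n m)%N -> (\rank X <= r)%N ->
  S^T *m X = 0 -> X *m S^T = 0 -> sigma 1 S <= sigma r X ->
  (\rank M <= r)%N ->
  2^-1 * inner X X - inner X (X + S) <= 2^-1 * inner M M - inner M (X + S).
Proof.
move=> hr rk SX XS sS rM.
have nm : (1 <= minn n m)%N by case/andP: hr; exact: leq_trans.
have [P [d [PP XX d0]]] := gram_diagonalization X.
have s0 : 0 <= sigma r X := sigma_ge0 X hr.
have XtS : X^T *m S = 0 by rewrite -[LHS]trmxK trmx_mul trmxK SX trmx0.
have SXt : S *m X^T = 0 by rewrite -[LHS]trmxK trmx_mul trmxK XS trmx0.
have inXS p (A B : 'M[R]_(m, p)) : inner (X *m A) (S *m B) = 0.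
  by rewrite inner_mull mulmxA XtS mul0mx /inner mulmx0 mxtrace0.
have inXS0 : inner X S = 0 by have := inXS _ 1%:M 1%:M; rewrite !mulmx1.
have [Q [Qs QQ MQ trQ]] := row_projection M.
have [E [W [Es EE EW trE XE]]] := singular_projection hr rk.
have SE : S *m E = 0 by rewrite -Es EW trmx_mul mulmxA SXt mul0mx.
have SQ : inner (S *m Q) (S *m Q) <= sigma r X ^+ 2 * (\tr Q - \tr (Q *m E)).
  have -> : S *m Q = S *m ((1%:M - E) *m Q).
    by rewrite mulmxA mulmxBr mulmx1 SE subr0.
  rewrite -inner_proj_compl // -inner_tr !trmx_mul (tr_compl Es) Qs -!mulmxA.
  rewrite -[inner _ _ in leRHS]inner_tr trmx_mul (tr_compl Es) Qs.
  have -> : Q *m ((1%:M - E) *m S^T) = (S *m ((1%:M - E) *m Q))^T.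
    by rewrite !trmx_mul (tr_compl Es) Qs mulmxA.
  by rewrite inner_tr; exact: sigma1_le_inner.
have XQ : sigma r X ^+ 2 * (\tr E - \tr (Q *m E)) <=
    inner (X *m (1%:M - Q)) (X *m (1%:M - Q)).
  by rewrite (mxtrace_mulC Q) -inner_proj_compl //; exact: XE.
have trEQ : sigma r X ^+ 2 * \tr Q <= sigma r X ^+ 2 * \tr E.
  case: (sigma_eq0_or_rank PP XX d0 hr rk) => [->|rX].
    by rewrite expr0n !mul0r.
  by rewrite ler_wpM2l ?sqr_ge0 // trQ trE ler_nat rX.
have splitX : inner X X = inner (X *m Q) (X *m Q) +
    inner (X *m (1%:M - Q)) (X *m (1%:M - Q)).
  have : inner (X *m Q) (X *m (1%:M - Q)) = 0.
    by rewrite inner_mulr Qs -mulmxA mulmxBl mul1mx QQ subrr /inner !mulmx0 mxtrace0.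
  rewrite mulmxBr mulmx1; have := innerC X (X *m Q).
  by rewrite !innerE; lra.
have MT : inner M ((X + S) *m Q) = inner M (X + S).
  by rewrite -{2}MQ inner_mulr Qs.
have := inner_ge0 (M - (X + S) *m Q); have := innerC ((X + S) *m Q) M.
have := innerC (S *m Q) (X *m Q); have := inXS _ Q Q.
move: MT; rewrite mulmxDl !innerE inXS0; lra.
Qed.

Lemma linear_le_quadratic (R : realFieldType) (a b : R) :
  (forall t, t * a <= t ^+ 2 * b) -> a = 0.
Proof.
move=> h; apply/eqP/negPn/negP => a0.
have a2 : 0 < a ^+ 2 by rewrite lt_def sqr_ge0 sqrf_eq0 a0.
pose c := `|b| + 1; have c0 : 0 < c by rewrite ltr_wpDl.
have bc : b < c by rewrite (le_lt_trans (ler_norm b)) // ltrDl.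
have := h (a / c).
have -> : a / c * a = a ^+ 2 / c by rewrite expr2 mulrAC.
have -> : (a / c) ^+ 2 * b = a ^+ 2 / c * (b / c) by field; rewrite gt_eqF.
rewrite ler_pMr ?divr_gt0 // ler_pdivlMr // mul1r leNgt.
by rewrite bc.
Qed.

(** Optimality says that <E, S> <= |E|^2 / 2 for every perturbation E with
    rank (X + E) <= r.  The perturbations t X X^T S and t S X^T X leave the rank
    bound intact for every t and give the two orthogonality relations.  For the
    bound on the norm of S at a vector v, one adds a multiple of the rank-one
    matrix S v^T v; when rank X = r, room is made by first removing from X its
    smallest singular component, at the cost sigma_r^2 in |E|^2. *)
Lemma rank_constrained_min_necessary (R : realType) (n m r : nat)
    (X S : 'M[R]_(n, m)) :
  (1 <= r <= minn n m)%N -> (\rank X <= r)%N ->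
  (forall M : 'M[R]_(n, m), (\rank M <= r)%N ->
     2^-1 * inner X X - inner X (X + S) <= 2^-1 * inner M M - inner M (X + S)) ->
  [/\ S^T *m X = 0, X *m S^T = 0 & sigma 1 S <= sigma r X].
Proof.
move=> hr rk h.
have nm : (1 <= minn n m)%N by case/andP: hr; exact: leq_trans.
have [P [d [PP XX d0]]] := gram_diagonalization X.
have s0 : 0 <= sigma r X := sigma_ge0 X hr.
have hE (E : 'M[R]_(n, m)) : (\rank (X + E)%R <= r)%N ->
    inner E S <= 2^-1 * inner E E.
  by move=> /h; have := innerC E X; rewrite !innerE; lra.
have XtS : X^T *m S = 0.
  apply: inner_eq0; rewrite -inner_mull.
  apply: (@linear_le_quadratic _ _ (2^-1 * inner (X *m (X^T *m S)) (X *m (X^T *m S)))) => t.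
  have := hE (t *: (X *m (X^T *m S))); rewrite !innerE => h'.
  suff /h' : (\rank (X + t *: (X *m (X^T *m S)))%R <= r)%N by lra.
  rewrite scalemxAr -[X in X + _]mulmx1 -mulmxDr.
  by apply: leq_trans rk; exact: mxrankM_maxl.
have XSt : X *m S^T = 0.
  suff SXt : S *m X^T = 0 by rewrite -[LHS]trmxK trmx_mul trmxK SXt trmx0.
  apply: inner_eq0; rewrite -{2}[X]trmxK -[inner _ _]inner_mulr.
  rewrite trmxK.
  apply: (@linear_le_quadratic _ _ (2^-1 * inner (S *m X^T *m X) (S *m X^T *m X))) => t.
  have := hE (t *: (S *m X^T *m X)); rewrite !innerE => h'.
  suff /h' : (\rank (X + t *: (S *m X^T *m X))%R <= r)%N by lra.
  rewrite scalemxAl -{1}[X]mul1mx -mulmxDl.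
  by apply: leq_trans rk; exact: mxrankM_maxr.
split=> //; first by rewrite -[LHS]trmxK trmx_mul trmxK XtS trmx0.
apply/(sigma1_le _ nm s0) => v.
set a := (v *m _ *m v^T) 0 0; set b := (v *m v^T) 0 0.
pose B := S *m v^T *m v.
have aE : inner (S *m v^T) (S *m v^T) = a by rewrite inner_gram trmxK trace_mx11.
have bE : inner v^T v^T = b by rewrite /inner trmxK trace_mx11.
have BS : inner B S = a by rewrite /B inner_mulr.
have BB : inner B B = b * a.
  rewrite {1}/B inner_mulr /B -mulmxA [v *m _]mx11_scalar mul_mx_scalar.
  by rewrite innerZr aE.
have a0 : 0 <= a by rewrite -aE inner_ge0.
have b0 : 0 <= b by rewrite -bE inner_ge0.
move: rk; rewrite leq_eqVlt => /predU1P[rX|rX]; last first.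
  suff -> : a = 0 by rewrite mulr_ge0 ?sqr_ge0.
  apply: (@linear_le_quadratic _ _ (2^-1 * (b * a))) => t.
  have := hE (t *: B); rewrite !innerE BS BB => h'.
  suff /h' : (\rank (X + t *: B)%R <= r)%N by lra.
  apply: leq_trans (mxrank_add _ _) _; rewrite -addn1 in rX.
  apply: leq_trans rX; rewrite leq_add2l (leq_trans (mxrank_scale _ _)) //.
  by rewrite (leq_trans (mxrankM_maxr _ _)) // rank_leq_row.
have [u [uu uXX]] := sigma_eigenrow X hr.
have s20 : sigma r X ^+ 2 != 0 by rewrite sqrf_eq0 (sigma_neq0 PP XX d0 hr rX).
have uX : (u <= X)%MS.
  apply/submxP; exists ((sigma r X ^+ 2)^-1 *: (u *m X^T)).
  by rewrite -scalemxAl -mulmxA uXX scalerA mulVf // scale1r.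
(* The singular component of X along u, of squared norm sigma_r^2. *)
pose D := X *m u^T *m u.
have DS (B' : 'M[R]_(m, m)) : inner D (S *m B') = 0.
  by rewrite /D -mulmxA inner_mull mulmxA XtS mul0mx /inner mulmx0 mxtrace0.
have DD : inner D D = sigma r X ^+ 2.
  rewrite {1}/D inner_mulr /D -mulmxA uu mulmx1 inner_gram trmxK uXX.
  by rewrite -scalemxAl uu trace_mx11 mxE !mxE mulr1.
have key t : t * a <= 2^-1 * (sigma r X ^+ 2 + t ^+ 2 * (b * a)).
  have := hE (t *: B - D); have := DS 1%:M; rewrite mulmx1 => DS0.
  have DB : inner D B = 0 by rewrite /B -mulmxA DS.
  rewrite !innerE (innerC B D) DB DS0 BS BB DD => h'.
  suff /h' : (\rank (X + (t *: B - D))%R <= r)%N by lra.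
  rewrite addrCA (leq_trans (mxrank_add _ _)) // -rX.
  apply: leq_trans (rank_deflate uu uX); rewrite -add1n leq_add2r.
  rewrite (leq_trans (mxrank_scale _ _)) //.
  by rewrite (leq_trans (mxrankM_maxr _ _)) // rank_leq_row.
have [b_eq0|bn0] := eqVneq b 0.
  have : v^T = 0 by apply: inner_eq0; rewrite bE.
  by move=> v0; rewrite b_eq0 mulr0 -aE v0 mulmx0 /inner mulmx0 mxtrace0.
have bp : 0 < b by rewrite lt_def bn0.
(* t = 1 / b is the maximizer of t a - t^2 a b / 2. *)
have := key b^-1.
have -> : b^-1 ^+ 2 * (b * a) = b^-1 * a by field.
by rewrite -[a <= _]ler_pdivrMr // [b^-1 * a]mulrC; lra.
Qed.

Theorem rank_constrained_minimizer (R : realType) (n m r : nat)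
    (X S : 'M[R]_(n, m)) :
  (1 <= r <= minn n m)%N -> (\rank X <= r)%N ->
  (forall M : 'M[R]_(n, m), (\rank M <= r)%N ->
     2^-1 * inner X X - inner X (X + S) <= 2^-1 * inner M M - inner M (X + S))
  <-> [/\ S^T *m X = 0, X *m S^T = 0 & sigma 1 S <= sigma r X].
Proof.
move=> hr rk; split=> [|[SX XS sS] M]; first exact: rank_constrained_min_necessary.
exact: rank_constrained_min_sufficient.
Qed.

(** * Subdifferentials and proximal points *)

Lemma linear_ge0 (R : realFieldType) (a b : R) :
  (forall t, 0 < t <= 1 -> 0 <= t * a + t ^+ 2 * b) -> 0 <= a.
Proof.
move=> h; rewrite leNgt; apply/negP => a0.
pose c := `|b| - a; have c0 : 0 < c by rewrite /c ltr_wpDl // oppr_gt0.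
(* At t = - a / c the quadratic term cannot compensate the negative slope. *)
have t01 : 0 < - a / c <= 1.
  by rewrite divr_gt0 ?oppr_gt0 //= ler_pdivrMr // mul1r /c lerDr.
have /andP[t0 _] := t01.
have := h _ t01; rewrite expr2 -mulrA -mulrDr pmulr_rge0 //.
apply/negP; rewrite -ltNge.
have tb : - a / c * b <= - a / c * `|b| by rewrite ler_pM2l // ler_norm.
have : - a / c * `|b| = - a - a * a / c.
  by rewrite /c; field; rewrite gt_eqF.
have : 0 < a * a / c by rewrite divr_gt0 // nmulr_lgt0.
lra.
Qed.

Lemma cvg_inner (R : realType) (n m : nat) (T : Type) (F : set_system T)
    {FF : Filter F} (X Y : T -> 'M[R]_(n, m)) (x y : 'M[R]_(n, m)) :
  X k @[k --> F] --> x -> Y k @[k --> F] --> y ->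
  inner (X k) (Y k) @[k --> F] --> inner x y.
Proof.
move=> Xx Yy; rewrite inner_entries.
under eq_fun do rewrite inner_entries.
have entry U (u : 'M[R]_(n, m)) i j :
    U k @[k --> F] --> u -> U k i j @[k --> F] --> u i j.
  by move=> Uu; exact: (cvg_comp _ _ Uu (@coord_continuous R n m i j u)).
apply: cvg_big => [|i _]; first exact: add_continuous.
apply: cvg_big => [|j _]; first exact: add_continuous.
by apply: cvgM; exact: entry.
Qed.

Section Subdifferential.
Variables (R : realType) (n m : nat).
Implicit Types (f h : 'M[R]_(n, m) -> \bar R) (X Y Z G : 'M[R]_(n, m)).

Lemma subdifferential_fin_num h X G :
  proper_fun h -> subdifferential h X G -> h X \is a fin_num.
Proof.
move=> [hN [Y hY]] sG; have := sG Y; rewrite fin_numE.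
have := hN X; case: (h X) => [x| |] //= _.
by rewrite addye // leye_eq => /eqP.
Qed.

(** Lower semicontinuity enters through closed sublevel sets: for each e > 0 the
    iterates eventually lie in the sublevel set of height
    h Y - <g, Y - x> + e, and so does their limit. *)
Lemma subdifferential_closed h (X G : nat -> 'M[R]_(n, m))
    (x g : 'M[R]_(n, m)) :
  proper_fun h -> closed_fun h ->
  (forall k, subdifferential h (X k) (G k)) ->
  X k @[k --> \oo] --> x -> G k @[k --> \oo] --> g ->
  subdifferential h x g.
Proof.
move=> [hN hp] hc sG Xx Gg Y.
have := hN Y; case hY : (h Y) => [y| |] //= _; last by rewrite leey.
have cv : y - inner (G k) (Y - X k) @[k --> \oo] --> y - inner g (Y - x).
  by apply: cvgB; [exact: cvg_cst|apply: cvg_inner => //; apply: cvgB => //; exact: cvg_cst].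
suff : (h x <= (y - inner g (Y - x))%:E)%E.
  by rewrite EFinB leeBrDr.
apply/lee_addgt0Pr => e e0; rewrite -EFinD.
apply: (closed_cvg _ (hc _) _ _ Xx).
have lt_c : y - inner g (Y - x) < y - inner g (Y - x) + e by rewrite ltrDl.
apply: filterS (cvgr_le _ cv _ lt_c) => k /= le_k.
apply: (@le_trans _ _ (y - inner (G k) (Y - X k))%:E).
  by rewrite EFinB leeBrDr // -hY; exact: sG.
by rewrite lee_fin.
Qed.

Lemma sqdist_expand X Y Z : inner (Y - Z) (Y - Z) =
  inner (X - Z) (X - Z) + 2 * inner (X - Z) (Y - X) + inner (Y - X) (Y - X).
Proof.
have -> : Y - Z = (X - Z) + (Y - X) by rewrite [RHS]addrC subrKA.
move: (X - Z) (Y - X) => A B; rewrite !innerE (innerC B A); ring.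
Qed.

Lemma prox_fin_num h (gamma : R) Z X : 0 < gamma -> proper_fun h ->
  prox (fun M => gamma%:E * h M)%E Z X -> h X \is a fin_num.
Proof.
move=> g0 [hN [Y hY]] pX; have := pX Y; rewrite /= fin_numE.
have := hN X; case: (h X) => [x| |] //= _.
have := hN Y; case: (h Y) hY => [y| |] //= _ _.
by rewrite gt0_muley ?lte_fin // addye // -EFinM -EFinD leye_eq => /eqP.
Qed.

(** Compare X with the points X + t (Y - X) of a segment and let t tend to 0:
    the quadratic term of the proximal objective contributes only its
    derivative. *)
Lemma prox_subdifferential h (gamma : R) Z X :
  0 < gamma -> proper_fun h -> convex_fun h ->
  prox (fun M => gamma%:E * h M)%E Z X ->
  subdifferential h X (gamma^-1 *: (Z - X)).
Proof.
move=> g0 hp hc pX Y; have := prox_fin_num g0 hp pX.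
have := hp.1 Y; case hY : (h Y) => [y| |] //= _; last by rewrite leey.
case hX : (h X) => [x| |] //= _.
rewrite -EFinD lee_fin.
suff : 0 <= gamma * (y - x) + inner (X - Z) (Y - X).
  rewrite innerZl -subr_ge0 -(pmulr_rge0 _ g0) => H.
  apply: le_trans H _; rewrite le_eqVlt; apply/orP; left; apply/eqP.
  by rewrite -(opprB X Z) innerNl; field; rewrite gt_eqF.
apply: (@linear_ge0 _ _ (2^-1 * inner (Y - X) (Y - X))) => t /andP[t0 t1].
have t01 : 0 <= t <= 1 by rewrite ltW.
pose N := t *: Y + (1 - t) *: X.
have hN : (h N <= (t * y + (1 - t) * x)%:E)%E.
  by have := hc t Y X t01; rewrite hX hY -!EFinM -EFinD.
have := pX N; rewrite /= hX !frob_sqr.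
have := hp.1 N; case: (h N) hN => [z| |] //= zle _.
rewrite lee_fin in zle; rewrite -!EFinM -!EFinD lee_fin (sqdist_expand X N).
have -> : N - X = t *: (Y - X).
  by apply/matrixP => i j; rewrite !mxE; ring.
rewrite !innerZl !innerZr.
have := ler_wpM2l (ltW g0) zle; lra.
Qed.

(** The proximal objective exceeds its minimum by at least half of the squared
    distance to the minimizer; this yields both optimality and uniqueness. *)
Lemma subdifferential_prox_gap h (gamma : R) Z X Y :
  0 < gamma -> proper_fun h ->
  subdifferential h X (gamma^-1 *: (Z - X)) ->
  (gamma%:E * h X + (2^-1 * frob (X - Z) ^+ 2)%:E
     + (2^-1 * inner (Y - X) (Y - X))%:E
   <= gamma%:E * h Y + (2^-1 * frob (Y - Z) ^+ 2)%:E)%E.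
Proof.
move=> g0 hp sX; have := subdifferential_fin_num hp sX; have := sX Y.
case hX : (h X) => [x| |] //= + _.
have := hp.1 Y; case hY : (h Y) => [y| |] //= _; last first.
  by move=> _; rewrite gt0_muley ?lte_fin // addye // leey.
rewrite -!EFinM -!EFinD !lee_fin !frob_sqr (sqdist_expand X Y Z) innerZl.
rewrite -(ler_pM2l g0) mulrDr mulrA mulfV ?gt_eqF // mul1r.
rewrite -(opprB X Z) innerNl; lra.
Qed.

Lemma subdifferential_prox h (gamma : R) Z X :
  0 < gamma -> proper_fun h ->
  subdifferential h X (gamma^-1 *: (Z - X)) ->
  prox (fun M => gamma%:E * h M)%E Z X.
Proof.
move=> g0 hp sX Y /=; apply: le_trans (subdifferential_prox_gap Y g0 hp sX).
by rewrite leeDl // lee_fin mulr_ge0 // inner_ge0.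
Qed.

Lemma subdifferential_prox_unique h (gamma : R) Z X :
  0 < gamma -> proper_fun h ->
  subdifferential h X (gamma^-1 *: (Z - X)) ->
  prox (fun M => gamma%:E * h M)%E Z = [set X].
Proof.
move=> g0 hp sX; apply/seteqP; split=> [Y pY /=|_ ->]; last first.
  exact: subdifferential_prox.
have := pY X; have /= := subdifferential_prox_gap Y g0 hp sX => /le_trans h1 /h1.
have := subdifferential_fin_num hp sX; case: (h X) => [x| |] //= _.
rewrite -EFinM -!EFinD lee_fin gerDl pmulr_rle0 // => YX0.
have : inner (Y - X) (Y - X) = 0 by apply/eqP; rewrite eq_le YX0 inner_ge0.
by move=> /inner_eq0/eqP; rewrite subr_eq0 => /eqP.
Qed.
End Subdifferential.

(** * Conjugates and the rank-constrained quadratic *)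

Section Conjugate.
Variables (R : realType) (n m : nat).
Implicit Types (g : 'M[R]_(n, m) -> \bar R) (X Y : 'M[R]_(n, m)).

Lemma conjugate_ge g X Y : ((inner X Y)%:E - g X <= conjugate g Y)%E.
Proof. by apply: ereal_sup_ubound; exists X. Qed.

Lemma conjugate_le g Y (a : \bar R) :
  (forall X, ((inner X Y)%:E - g X <= a)%E) -> (conjugate g Y <= a)%E.
Proof. by move=> h; apply: ge_ereal_sup => _ [X _ <-]. Qed.

Lemma conjugate_convex g : (forall X, g X <> -oo%E) -> convex_fun (conjugate g).
Proof.
move=> gN t Y1 Y2 /andP[t0 t1]; apply: conjugate_le => X.
have := conjugate_ge g X Y1; have := conjugate_ge g X Y2.
have := gN X; case: (g X) => [c| |] //= _; last by move=> *; exact: leNye.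
move=> /(lee_wpmul2l _) h2 /(lee_wpmul2l _) h1.
have t1' : 0 <= 1 - t by rewrite subr_ge0.
apply: le_trans (leeD (h1 t%:E _) (h2 (1 - t)%:E _)); rewrite ?lee_fin //.
by rewrite !innerDr !innerZr; lra.
Qed.

Lemma conjugate_closed g : (forall X, g X <> -oo%E) -> closed_fun (conjugate g).
Proof.
move=> gN a.
have -> : [set Y | (conjugate g Y <= a%:E)%E] =
    \bigcap_X [set Y | ((inner X Y)%:E - g X <= a%:E)%E].
  apply/seteqP; split=> [Y /= h X _ /=|Y h /=].
    exact: le_trans (conjugate_ge g X Y) h.
  by apply: conjugate_le => X; exact: h.
apply: closed_bigI => X _.
have := gN X; case: (g X) => [c| |] //= _; last first.
  rewrite (_ : [set _ | _] = setT); first exact: closedT.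
  by apply/seteqP; split=> // Y _ /=; rewrite leNye.
rewrite (_ : [set _ | _] = inner X @^-1` [set x | x <= a + c]); last first.
  by apply/seteqP; split=> Y /=; rewrite -EFinB lee_fin lerBlDr.
apply: preimage_closed; last exact: closed_le.
move=> Y _; apply: (@cvg_inner _ _ _ _ (nbhs Y) _ (fun=> X) id X Y).
  exact: cvg_cst.
exact: cvg_id.
Qed.

Lemma biconjugate_le g X : (g X \is a fin_num) -> (biconjugate g X <= g X)%E.
Proof.
move=> gX; apply: conjugate_le => Y; have := conjugate_ge g X Y.
case: (g X) gX => [x| |] //= _; rewrite (innerC Y).
case: (conjugate g Y) => [c| |] //=; last by rewrite leNye.
by rewrite -!EFinB !lee_fin; lra.
Qed.
End Conjugate.

Section RankConstrained.
Variables (R : realType) (n m r : nat).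
Implicit Types (X Y M S Z : 'M[R]_(n, m)).

Lemma f1E M : (\rank M <= r)%N -> f1 r M = (2^-1 * inner M M)%:E.
Proof. by move=> rM; rewrite /f1 /chi_rank rM adde0 frob_sqr. Qed.

Lemma f1_ninfty M : f1 r M <> -oo%E.
Proof. by rewrite /f1 /chi_rank; case: ifP. Qed.

Lemma f1_proper : proper_fun (@f1 R n m r).
Proof.
split; first exact: f1_ninfty.
by exists 0; rewrite f1E // mxrank0.
Qed.

Lemma f1_rank M : f1 r M <> +oo%E -> (\rank M <= r)%N.
Proof. by rewrite /f1 /chi_rank; case: ifP. Qed.

Lemma conjugate_f1_le (Y : 'M[R]_(n, m)) (a : R) :
  (forall M, (\rank M <= r)%N -> inner M Y - 2^-1 * inner M M <= a) ->
  (conjugate (f1 r) Y <= a%:E)%E.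
Proof.
move=> h; apply: conjugate_le => M; case: (leqP (\rank M) r) => rM.
  by rewrite f1E // -EFinB lee_fin h.
by rewrite /f1 /chi_rank leqNgt rM /= leNye.
Qed.

Lemma conjugate_f1_ninfty Y : conjugate (f1 r) Y <> -oo%E.
Proof.
have := conjugate_ge (f1 r) 0 Y; rewrite f1E ?mxrank0 // -EFinB.
by case: (conjugate _ _).
Qed.

(** Test the supremum at Y = X, where the conjugate is at most |X|^2 / 2. *)
Lemma biconjugate_f1_ge X : ((2^-1 * inner X X)%:E <= biconjugate (f1 r) X)%E.
Proof.
apply: le_trans (conjugate_ge (conjugate (f1 r)) X X).
have : (conjugate (f1 r) X <= (2^-1 * inner X X)%:E)%E.
  apply: conjugate_f1_le => M _.
  by have := inner_ge0 (M - X); rewrite !innerE (innerC X M); lra.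
have := @conjugate_f1_ninfty X; case: (conjugate _ _) => [c| |] //= _.
by rewrite -EFinB !lee_fin; lra.
Qed.

Lemma biconjugate_f1E X : (\rank X <= r)%N ->
  biconjugate (f1 r) X = (2^-1 * inner X X)%:E.
Proof.
move=> rX; apply/eqP; rewrite eq_le biconjugate_f1_ge andbT -f1E //.
by apply: biconjugate_le; rewrite f1E.
Qed.

Lemma biconjugate_f1_proper : proper_fun (biconjugate (@f1 R n m r)).
Proof.
split=> [X|]; first by have := biconjugate_f1_ge X; case: (biconjugate _ _).
by exists 0; rewrite biconjugate_f1E // mxrank0.
Qed.

(** The biconjugate agrees with the rank-constrained function at X, so a
    subgradient inequality tested on matrices of rank at most r is the right
    side.  Conversely the right side bounds the conjugate at G, which makes
    N |-> <N, G> minus that bound an affine minorant of the biconjugate that is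
    exact at X. *)
Lemma subdifferential_biconjugate_f1 X G : (\rank X <= r)%N ->
  subdifferential (biconjugate (f1 r)) X G <->
  forall M, (\rank M <= r)%N ->
    2^-1 * inner X X - inner X G <= 2^-1 * inner M M - inner M G.
Proof.
move=> rX; split=> [sG M rM|h N].
  have := sG M; rewrite !biconjugate_f1E // -EFinD lee_fin.
  by rewrite !innerE !(innerC G); lra.
apply: le_trans (conjugate_ge (conjugate (f1 r)) G N).
rewrite biconjugate_f1E // -EFinD.
have : (conjugate (f1 r) G <= (inner X G - 2^-1 * inner X X)%:E)%E.
  by apply: conjugate_f1_le => M /h; lra.
have := @conjugate_f1_ninfty G; case: (conjugate _ _) => [c| |] //= _.
by rewrite -EFinB !lee_fin !innerE !(innerC G); lra.
Qed.

Lemma prox_f1P (gamma : R) Z X : 0 < gamma ->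
  prox (fun M => gamma%:E * f1 r M)%E Z X <->
  (\rank X <= r)%N /\ forall M, (\rank M <= r)%N ->
    gamma * (2^-1 * inner X X) + 2^-1 * inner (X - Z) (X - Z) <=
    gamma * (2^-1 * inner M M) + 2^-1 * inner (M - Z) (M - Z).
Proof.
move=> g0; split=> [pX|[rX h] M /=].
  have rX : (\rank X <= r)%N.
    apply: f1_rank; have := prox_fin_num g0 f1_proper pX.
    by case: (f1 r X).
  split=> // M rM; have := pX M; rewrite /= !f1E // !frob_sqr.
  by rewrite -!EFinM -!EFinD lee_fin.
case: (leqP (\rank M) r) => rM.
  by rewrite !f1E // !frob_sqr -!EFinM -!EFinD lee_fin h.
by rewrite {2}/f1 /chi_rank leqNgt rM /= gt0_muley ?lte_fin // addye // leey.
Qed.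
End RankConstrained.

(** * Limit points of the iteration *)

(** The rank-constrained quadratic is not convex, so the passage to the limit
    uses the minimality inequalities themselves; those concern only matrices of
    rank at most r, where the function is continuous. *)
Lemma prox_f1_closed (R : realType) (n m r : nat) (gamma : R)
    (X Z : nat -> 'M[R]_(n, m)) (x z : 'M[R]_(n, m)) :
  0 < gamma -> (\rank x <= r)%N ->
  (forall k, prox (fun M => gamma%:E * f1 r M)%E (Z k) (X k)) ->
  X k @[k --> \oo] --> x -> Z k @[k --> \oo] --> z ->
  prox (fun M => gamma%:E * f1 r M)%E z x.
Proof.
move=> g0 rx pX Xx Zz; apply/(prox_f1P _ _ _ g0); split=> // M rM.
have XZ : X k - Z k @[k --> \oo] --> x - z by exact: cvgB.
have MZ : M - Z k @[k --> \oo] --> M - z by apply: cvgB => //; exact: cvg_cst.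
apply: (@ler_cvg_to _ \oo _ _
  (fun k => gamma * (2^-1 * inner (X k) (X k)) + 2^-1 * inner (X k - Z k) (X k - Z k))
  (fun k => gamma * (2^-1 * inner M M) + 2^-1 * inner (M - Z k) (M - Z k))).
- apply: cvgD; (do ?[apply: cvgM; first exact: cvg_cst]); exact: cvg_inner.
- apply: cvgD; first exact: cvg_cst.
  apply: cvgM; first exact: cvg_cst.
  exact: cvg_inner.
- by near=> k; apply: (proj2 ((prox_f1P _ _ _ g0).1 (pX k))).
Unshelve. all: by end_near. Qed.

Lemma prox_closed (R : realType) (n m : nat) (h : 'M[R]_(n, m) -> \bar R)
    (gamma : R) (X Z : nat -> 'M[R]_(n, m)) (x z : 'M[R]_(n, m)) :
  0 < gamma -> proper_fun h -> closed_fun h -> convex_fun h ->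
  (forall k, prox (fun M => gamma%:E * h M)%E (Z k) (X k)) ->
  X k @[k --> \oo] --> x -> Z k @[k --> \oo] --> z ->
  subdifferential h x (gamma^-1 *: (z - x)).
Proof.
move=> g0 hp hcl hcv pX Xx Zz.
apply: (subdifferential_closed hp hcl (X := X)
  (G := fun k => gamma^-1 *: (Z k - X k))) => // [k|].
  exact: prox_subdifferential.
by apply: cvgZr; exact: cvgB.
Qed.

(** Convergence of Z_k forces Y_k - X_k to vanish because rho is nonzero, so
    X_k and Y_k have the same limit, and closedness of both proximal graphs gives
    the fixed-point relations.  Conversely a fixed point is the limit of the
    constant iteration. *)
Lemma DR_limit_pointP (R : realType) (n m : nat)
    (h f2 : 'M[R]_(n, m) -> \bar R) (gamma rho : R) (Xs : 'M[R]_(n, m)) :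
  0 < gamma -> rho != 0 ->
  proper_fun f2 -> closed_fun f2 -> convex_fun f2 ->
  (forall (X Z : nat -> 'M[R]_(n, m)) z,
    (forall k, prox (fun M => gamma%:E * h M)%E (Z k) (X k)) ->
    X k @[k --> \oo] --> Xs -> Z k @[k --> \oo] --> z ->
    prox (fun M => gamma%:E * h M)%E z Xs) ->
  DR_limit_point h f2 gamma rho Xs <->
  exists Zs, prox (fun M => gamma%:E * h M)%E Zs Xs /\
    subdifferential f2 Xs (gamma^-1 *: (Xs - Zs)).
Proof.
move=> g0 rho0 f2p f2cl f2cv hcl; split.
  move=> [X [Y [Z [it [Zs Zc] Xc]]]].
  have Xc1 : X k.+1 @[k --> \oo] --> Xs by rewrite cvg_shiftS.
  have Zc1 : Z k.+1 @[k --> \oo] --> Zs by rewrite cvg_shiftS.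
  exists Zs; split.
    by apply: (hcl (fun k => X k.+1) Z) => // k; case: (it k).
  have YE k : Y k.+1 = X k.+1 + rho^-1 *: (Z k.+1 - Z k).
    have [_ _ ->] := it k.
    by rewrite [Z k + _]addrC addrK scalerA mulVf // scale1r [RHS]addrC subrK.
  have Yc : Y k.+1 @[k --> \oo] --> Xs.
    under eq_fun do rewrite YE.
    have : X k.+1 + rho^-1 *: (Z k.+1 - Z k) @[k --> \oo] -->
        Xs + rho^-1 *: (Zs - Zs).
      by apply: cvgD => //; apply: cvgZr; exact: cvgB.
    by rewrite subrr scaler0 addr0.
  have -> : Xs - Zs = (2 *: Xs - Zs) - Xs.
    by apply/matrixP => i j; rewrite !mxE; ring.
  apply: (prox_closed (X := fun k => Y k.+1)
    (Z := fun k => 2 *: X k.+1 - Z k)) => // [k|].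
    by have [_ E _] := it k; have : [set Y k.+1] (Y k.+1) by []; rewrite -E.
  by apply: cvgB => //; exact: cvgZr.
move=> [Zs [pXs sXs]].
exists (fun=> Xs), (fun=> Xs), (fun=> Zs); split.
- move=> k; split=> //; last by rewrite subrr scaler0 addr0.
  apply: subdifferential_prox_unique => //.
  rewrite (_ : 2 *: Xs - Zs - Xs = Xs - Zs) //.
  by apply/matrixP => i j; rewrite !mxE; ring.
- by exists Zs; exact: cvg_cst.
- exact: cvg_cst.
Qed.

Unset Implicit Arguments.

Theorem theorem2 (R : realType) (n m r : nat) (gamma rho : R)
    (f2 : 'M[R]_(n, m) -> \bar R) (Xs : 'M[R]_(n, m))
    (hr : (1 <= r <= minn m n)%N) (hgamma : 0 < gamma)
    (hrho : 0 < rho < 2)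
    (hproper : proper_fun f2) (hclosed : closed_fun f2) (hconvex : convex_fun f2)
    (hrank : (\rank Xs <= r)%N) :
  (DR_limit_point (biconjugate (f1 r)) f2 gamma rho Xs <->
     exists Rm : 'M[R]_(n, m),
       [/\ Rm^T *m Xs = 0, Xs *m Rm^T = 0,
           subdifferential f2 Xs (- Xs - Rm) &
           sigma 1 Rm <= sigma r Xs])
  /\
  (DR_limit_point (f1 r) f2 gamma rho Xs <->
     exists Rm : 'M[R]_(n, m),
       [/\ Rm^T *m Xs = 0, Xs *m Rm^T = 0,
           subdifferential f2 Xs (- Xs - Rm) &
           sigma 1 Rm <= (1 + gamma^-1) * sigma r Xs]).
Proof.
rewrite minnC in hr.
have rho0 : rho != 0 by case/andP: hrho => h _; rewrite gt_eqF.
have [g0 grn0] : 0 < 1 + gamma /\ gamma != 0.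
  by rewrite addr_gt0 // gt_eqF.
split.
  have bp := biconjugate_f1_proper R n m r.
  have bcl := conjugate_closed (@conjugate_f1_ninfty R n m r).
  have bcv := conjugate_convex (@conjugate_f1_ninfty R n m r).
  rewrite DR_limit_pointP // => [|X Z z pX Xc Zc]; last first.
    by apply: subdifferential_prox => //; exact: (prox_closed (X := X) (Z := Z)).
  split=> [[Zs [pX sX]]|[Rm [RX XR sX sR]]].
    pose Rm := gamma^-1 *: (Zs - Xs) - Xs; exists Rm.
    have := prox_subdifferential hgamma bp bcv pX.
    have -> : gamma^-1 *: (Zs - Xs) = Xs + Rm by rewrite /Rm [RHS]addrC subrK.
    move=> /(subdifferential_biconjugate_f1 _ hrank).
    move=> /(rank_constrained_minimizer _ hr hrank)[? ? ?]; split=> //.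
    by rewrite /Rm opprB addrA addNr add0r -scalerN opprB.
  have Z0 : gamma^-1 *: (Xs + gamma *: (Xs + Rm) - Xs) = Xs + Rm.
    by rewrite addrAC subrr add0r scalerA mulVf // scale1r.
  exists (Xs + gamma *: (Xs + Rm)); split.
    apply: subdifferential_prox => //; rewrite Z0.
    apply/(subdifferential_biconjugate_f1 _ hrank).
    exact/(rank_constrained_minimizer _ hr hrank).
  by rewrite -(opprB _ Xs) scalerN Z0 opprD.
(* gamma f1 plus the proximal term is, up to a constant, (1 + gamma) / 2 times the
   squared distance to Z / (1 + gamma), which equals Xs + c *: Rm. *)
pose c := gamma / (1 + gamma).
have c0 : 0 < c by rewrite divr_gt0.
rewrite DR_limit_pointP // => [|X Z z pX Xc Zc]; last first.
  exact: (prox_f1_closed (X := X) (Z := Z)).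
have cE : c^-1 = 1 + gamma^-1 by rewrite /c; field; rewrite grn0 gt_eqF.
have eqv Rm : prox (fun M => gamma%:E * f1 r M)%E (Xs + gamma *: (Xs + Rm)) Xs <->
    [/\ Rm^T *m Xs = 0, Xs *m Rm^T = 0 &
        sigma 1 Rm <= (1 + gamma^-1) * sigma r Xs].
  rewrite prox_f1P // -cE -sigma1_scale_le //; last 2 first.
  - by case/andP: hr; exact: leq_trans.
  - exact: sigma_ge0.
  have ZE : Xs + gamma *: (Xs + Rm) = (1 + gamma) *: (Xs + c *: Rm).
    by apply/matrixP => i j; rewrite !mxE /c; field; rewrite gt_eqF.
  have objE M : gamma * (2^-1 * inner M M) +
        2^-1 * inner (M - (Xs + gamma *: (Xs + Rm)))
                     (M - (Xs + gamma *: (Xs + Rm))) =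
      (1 + gamma) * (2^-1 * inner M M - inner M (Xs + c *: Rm)) +
      2^-1 * inner (Xs + gamma *: (Xs + Rm)) (Xs + gamma *: (Xs + Rm)).
    rewrite !ZE; move: (Xs + _) => W.
    by rewrite !innerE (innerC W M); field.
  have SX : (c *: Rm)^T *m Xs = 0 <-> Rm^T *m Xs = 0.
    rewrite [(c *: Rm)^T]linearZ /= -scalemxAl; split=> [/eqP|->]; last by rewrite scaler0.
    by rewrite scaler_eq0 gt_eqF //= => /eqP.
  have XS : Xs *m (c *: Rm)^T = 0 <-> Xs *m Rm^T = 0.
    rewrite [(c *: Rm)^T]linearZ /= -scalemxAr; split=> [/eqP|->]; last by rewrite scaler0.
    by rewrite scaler_eq0 gt_eqF //= => /eqP.
  split=> [[_ h]|[/SX RX /XS XR sR]].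
    have /(rank_constrained_minimizer _ hr hrank)[/SX ? /XS ? ?] // :
        forall M : 'M[R]_(n, m), (\rank M <= r)%N ->
        2^-1 * inner Xs Xs - inner Xs (Xs + c *: Rm) <=
        2^-1 * inner M M - inner M (Xs + c *: Rm).
    by move=> M /h; rewrite !objE lerD2r ler_pM2l.
  split=> // M rM; rewrite !objE lerD2r ler_pM2l //; move: M rM.
  by apply/(rank_constrained_minimizer _ hr hrank).
split=> [[Zs [pX sX]]|[Rm [RX XR sX sR]]].
  pose Rm := gamma^-1 *: (Zs - Xs) - Xs; exists Rm.
  have ZE : Zs = Xs + gamma *: (Xs + Rm).
    rewrite /Rm [Xs + (_ - _)]addrC subrK scalerA mulfV // scale1r.
    by rewrite [RHS]addrC subrK.
  move: pX; rewrite ZE => /eqv[? ? ?]; split=> //.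
  by rewrite /Rm opprB addrA addNr add0r -scalerN opprB.
exists (Xs + gamma *: (Xs + Rm)); split; first exact/eqv.
have -> : Xs - (Xs + gamma *: (Xs + Rm)) = - (gamma *: (Xs + Rm)).
  by rewrite opprD addrA subrr add0r.
by rewrite scalerN scalerA mulVf // scale1r opprD.
Qed.
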